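(* For each integer $\ell\ge1$, let $L_\ell^{\mathrm{int}}=\{w\in\{0,1\}^*\mid |w|_0=|w|_1=2\ell,\ \exists k,m\in\{1,\dots,\ell\}:\ \delta_{k,m}^{2\ell}(w)\in\{0101,1010,0110,1001\}\}$. Then $L_\ell^{\mathrm{int}}$ is $2\ell$-uniform and $\mathcal{G}_{L_\ell^{\mathrm{int}}}$ is exactly the class of $\ell$-interval graphs.
   Context: $|w|_a$ is the number of occurrences of letter $a$ in $w$; a binary word is $k$-uniform if it has exactly $k$ occurrences of $0$ and of $1$. For $\ell,d\ge1$ and $k,m\in\{1,\dots,\ell\}$, $\delta_{k,m}^{2\ell\to 2d}$ maps a $2\ell$-uniform binary word $w$ to the word obtained by deleting all occurrences of $0$ except the $(2k-1)$-st up to the $2(k-1+d)$-th occurrence of $0$, and all occurrences of $1$ except the $(2m-1)$-st up to the $2(m-1+d)$-th occurrence of $1$; $\delta_{k,m}^{2\ell}$ means $\delta_{k,m}^{2\ell\to2}$ (keeping the $(2k-1)$-st and $2k$-th $0$ and the $(2m-1)$-st and $2m$-th $1$). For a word $w$ and distinct letters $a,b$, $h_{a,b}(w)$ is obtained by replacing $a$ by $0$, $b$ by $1$ and deleting all other letters. For a language $L\subseteq\{0,1\}^*$ closed under exchanging $0$ and $1$ and a word $w$ with set of letters $V$, $G(L,w)$ is the graph on $V$ where distinct $u,v$ are adjacent iff $h_{u,v}(w)\in L$; $\mathcal{G}_L$ is the class of graphs isomorphic to some $G(L,w)$. A graph is an $\ell$-interval graph if each vertex $v$ can be assigned a union $f(v)$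 of $\ell$ closed real intervals such that distinct $u,v$ are adjacent iff $f(u)\cap f(v)\neq\emptyset$. *)

(* Defs.v *)
From HB Require Import structures.
From mathcomp Require Import all_boot all_order all_algebra.
From mathcomp Require Import all_classical all_reals.
Set Implicit Arguments.
Unset Strict Implicit.
Unset Printing Implicit Defensive.
Import Order.TTheory GRing.Theory Num.Theory.
Local Open Scope classical_set_scope.

Record sgraph := SGraph {
  vertex :> finType;
  adj : rel vertex;
  adj_sym : symmetric adj;
  adj_irr : irreflexive adj }.

Definition isomorphic (G H : sgraph) : Prop :=
  exists f : G -> H, bijective f /\ forall u v, adj (f u) (f v) = adj u v.

(* Binary words: the letter 0 is [false], the letter 1 is [true]. *)
Definition bword := seq bool.

Definition uniform (k : nat) (w : bword) : Prop :=
  count_mem false w = k /\ count_mem true w = k.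

Definition uniform_lang (k : nat) (L : set bword) : Prop :=
  forall w, L w -> uniform k w.

Definition exchange (w : bword) : bword := map negb w.

Definition exchange_closed (L : set bword) : Prop :=
  forall w, L w -> L (exchange w).

(* The letter at position i is the [occ w i]-th occurrence (counted from 1) of
   that letter in w. *)
Definition occ (w : bword) (i : nat) : nat :=
  count_mem (nth false w i) (take i.+1 w).

(* delta d k m is the map \delta_{k,m}^{2l -> 2d}; it does not depend on l,
   except through its intended domain of 2l-uniform words (and k, m in 1..l). *)
Definition delta (d k m : nat) (w : bword) : bword :=
  [seq nth false w i | i <- iota 0 (size w) &
     let p := if nth false w i then m else k in
     2 * p - 1 <= occ w i <= 2 * (p - 1 + d)].

Definition h (A : eqType) (a b : A) (w : seq A) : bword :=
  pmap (fun c => if c == a then Some false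
                 else if c == b then Some true else None) w.

Lemma h_exchange (A : eqType) (a b : A) (w : seq A) :
  a != b -> h b a w = exchange (h a b w).
Proof.
move=> nab; rewrite /h /exchange; elim: w => //= c w ->.
have [->|_] := eqVneq c b; first by rewrite eq_sym (negbTE nab).
by case: (c == a).
Qed.

Section WordGraph.
Variables (L : set bword) (hL : exchange_closed L) (A : finType) (w : seq A).

Definition word_adj : rel (seq_sub w) :=
  fun u v => (u != v) && (h (val u) (val v) w \in L).

Lemma word_adj_sym : symmetric word_adj.
Proof.
suff imp u v : word_adj u v -> word_adj v u.
  by move=> u v; apply/idP/idP; apply: imp.
case/andP=> nuv /set_mem Luv; rewrite /word_adj eq_sym nuv /=.
by apply/mem_set; rewrite h_exchange //; apply: hL.
Qed.

Lemma word_adj_irr : irreflexive word_adj.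
Proof. by move=> u; rewrite /word_adj eqxx. Qed.

(* [seq_sub w] is the finite type of letters occurring in w. *)
Definition word_graph : sgraph := SGraph word_adj_sym word_adj_irr.

End WordGraph.

Definition graph_class (L : set bword) (hL : exchange_closed L) (G : sgraph) :
    Prop :=
  exists (A : finType) (w : seq A), isomorphic G (word_graph hL w).

Definition L_int (l : nat) : set bword :=
  [set w | uniform (2 * l) w /\
     exists k m, [/\ 1 <= k <= l, 1 <= m <= l &
       delta 1 k m w \in
         [:: [:: false; true; false; true]; [:: true; false; true; false];
             [:: false; true; true; false]; [:: true; false; false; true]]]].

Lemma count_exchange (c : bool) (w : bword) :
  count_mem (~~ c) (exchange w) = count_mem c w.
Proof. by rewrite count_map; apply: eq_count => x /=; case: x c => [] []. Qed.

Lemma delta_exchange d k m w :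
  delta d m k (exchange w) = exchange (delta d k m w).
Proof.
rewrite /delta /exchange -map_comp size_map.
have nthE i : i \in iota 0 (size w) ->
    nth false (map negb w) i = ~~ nth false w i.
  by rewrite mem_iota add0n => /andP[_ lt_iw]; rewrite (nth_map false).
rewrite (eq_in_filter (a2 := fun i =>
    let p := if nth false w i then m else k in
    2 * p - 1 <= occ w i <= 2 * (p - 1 + d))); last first.
  move=> i /nthE iE; rewrite /occ iE -map_take count_exchange.
  by case: (nth false w i).
by apply/eq_in_map => i; rewrite mem_filter => /andP[_ /nthE].
Qed.

Lemma L_int_exchange_closed l : exchange_closed (L_int l).
Proof.
move=> w [[w0 w1] [k [m [hk hm hd]]]]; split.
  by split; [rewrite -w1 -(count_exchange true) | rewrite -w0 -(count_exchange false)].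
exists m, k; split=> //; rewrite delta_exchange.
by move: hd; rewrite !inE => /or4P[] /eqP ->.
Qed.

Section IntervalGraphs.
Variable R : realType.
Local Open Scope ring_scope.

Definition interval_union (l : nat) (X : set R) : Prop :=
  exists a b : 'I_l -> R, (forall i, a i <= b i) /\
    X = \bigcup_i `[a i, b i]%classic.

Definition interval_graph (l : nat) (G : sgraph) : Prop :=
  exists f : G -> set R, (forall v, interval_union l (f v)) /\
    forall u v : G, u != v -> (adj u v <-> f u `&` f v !=set0).

End IntervalGraphs.

(* Main.v *)
Require Import Defs.
From mathcomp Require Import all_boot all_order all_algebra.
From mathcomp Require Import all_classical all_reals.
From mathcomp Require Import zify lra.
Set Implicit Arguments.
Unset Strict Implicit.
Unset Printing Implicit Defensive.
Import Order.TTheory GRing.Theory Num.Theory.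

(** A letter is active after a prefix in which it occurs an odd number of times.
    The [k]-th interval of [u] and the [m]-th interval of [v] overlap iff some
    prefix contains [u] exactly [2k-1] times and [v] exactly [2m-1] times, so for
    [2l]-uniform words membership in [L_int l] says that [u] and [v] are active
    simultaneously at some prefix. Measuring real time by prefix length turns the
    activity periods of a letter into [l] closed intervals. Conversely, given an
    interval representation, list the left endpoints [x] in increasing order and
    write a word whose set of active letters passes through the sets
    [{v | x in f v}]: a union of [l] intervals is switched at most [2l] times, and
    the missing occurrences, even in number, are appended at the end. *)

(** * Prefixes with odd counts *)

Definition odd_prefix (A : eqType) (u v : A) (w : seq A) : Prop :=
  exists2 p, prefix p w & odd (count_mem u p) && odd (count_mem v p).

Lemma prefix_rcons_iff (A : eqType) (p w : seq A) (c : A) :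
  prefix p (rcons w c) <-> prefix p w \/ p = rcons w c.
Proof.
split=> [|[/prefix_trans|->]]; last 2 first.
- by apply; apply: prefix_rcons.
- exact: prefix_refl.
case/lastP: p => [|p d]; first by rewrite !prefix0s; left.
move=> /prefixP[s]; case/lastP: s => [|s e].
  by rewrite cats0 => ->; right.
by rewrite -rcons_cat => /rcons_inj[-> _]; left; rewrite prefix_prefix.
Qed.

(** Each letter read extends the image by at most one letter, so no prefix of the image is skipped.
    Both [delta] and [h] have this form, which lets prefix conditions be pulled back through
    them. *)
Lemma prefix_image (A B : eqType) (F : seq A -> seq B) (w : seq A) (s : seq B) :
    F [::] = [::] ->
    (forall v c, F (rcons v c) = F v \/ exists d, F (rcons v c) = rcons (F v) d) ->
  prefix s (F w) <-> exists2 p, prefix p w & s = F p.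
Proof.
move=> F0 FS; elim/last_ind: w s => [|w c IH] s.
  rewrite F0 prefixs0; split=> [/eqP->|[p]]; first by exists [::].
  by rewrite prefixs0 => /eqP-> ->; rewrite F0.
split=> [|[p /prefix_rcons_iff[pw|->] ->]]; last 2 first.
- have : prefix (F p) (F w) by apply/IH; exists p.
  case: (FS w c) => [->//|[d ->]] sw.
  by apply/prefix_rcons_iff; left.
- exact: prefix_refl.
case: (FS w c) => [E|[d E]]; rewrite E => sF.
  by have /IH[p pw ->] := sF; exists p => //; apply/prefix_rcons_iff; left.
have /prefix_rcons_iff[/IH[p pw ->]|->] := sF.
  by exists p => //; apply/prefix_rcons_iff; left.
by exists (rcons w c) => //; apply: prefix_refl.
Qed.

Section Delta.
Variables d k m : nat.

(** Whether a letter is kept depends only on the occurrences up to it, so [delta] can be computed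
    while reading from the left. *)
Lemma delta_rcons w c :
  delta d k m (rcons w c) =
  let p := if c then m else k in
  if 2 * p - 1 <= (count_mem c w).+1 <= 2 * (p - 1 + d)
  then rcons (delta d k m w) c else delta d k m w.
Proof.
have nthE i : i \in iota 0 (size w) -> nth false (rcons w c) i = nth false w i.
  by rewrite mem_iota add0n nth_rcons => /andP[_ ->].
have occE i : i \in iota 0 (size w) -> occ (rcons w c) i = occ w i.
  move=> iw; rewrite /occ nthE // -cats1 takel_cat //.
  by move: iw; rewrite mem_iota add0n.
rewrite {1}/delta size_rcons -(addn1 (size w)) iotaD add0n filter_cat map_cat /=.
rewrite /occ nth_rcons ltnn eqxx.
rewrite take_oversize ?size_rcons // -cats1 count_cat /= eqxx addn0 addn1.
have -> : [seq nth false (w ++ [:: c]) i | i <- iota 0 (size w) &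
     let p := if nth false (w ++ [:: c]) i then m else k in
     2 * p - 1 <= count_mem (nth false (w ++ [:: c]) i) (take i.+1 (w ++ [:: c]))
     <= 2 * (p - 1 + d)] = delta d k m w.
  rewrite cats1 /delta (eq_in_filter (a2 := fun i =>
    let p := if nth false w i then m else k in
    2 * p - 1 <= occ w i <= 2 * (p - 1 + d))); last first.
    by move=> i iw; rewrite -/(occ (rcons w c) i) occE // nthE.
  by apply/eq_in_map => i; rewrite mem_filter => /andP[_ /nthE].
case: ifP => _ /=; rewrite ?cats0 // nth_cat ltnn subnn /=.
by rewrite cats1.
Qed.

Lemma prefix_delta s w :
  prefix s (delta d k m w) <-> exists2 p, prefix p w & s = delta d k m p.
Proof.
apply: prefix_image => // v c; rewrite delta_rcons /=.
by case: ifP => _; [right; exists c|left].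
Qed.

End Delta.

(** The truncated subtraction accounts for the skipped initial occurrences, the minimum for the two
    that are kept. *)
Lemma count_delta k m c w :
  count_mem c (delta 1 k m w) =
  minn 2 (count_mem c w - 2 * ((if c then m else k) - 1)).
Proof.
elim/last_ind: w => [|w e IH]; first by rewrite sub0n.
rewrite delta_rcons /=; case: ifP; rewrite -?cats1 !count_cat IH /=;
  by case: c e {IH} => [] [] /=; lia.
Qed.

(** A prefix with one letter of each kind has length two, so the first two letters of [q] differ,
    and then the last two differ as well. This leaves exactly the four listed words. *)
Lemma delta_meetP (q : bword) :
    count_mem false q = 2 -> count_mem true q = 2 ->
  q \in [:: [:: false; true; false; true]; [:: true; false; true; false];
            [:: false; true; true; false]; [:: true; false; false; true]] <->
  exists2 p, prefix p q & count_mem false p = 1 /\ count_mem true p = 1.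
Proof.
move=> q0 q1; split.
  by rewrite !inE => /or4P[] /eqP->;
    [exists [:: false; true]|exists [:: true; false]
    |exists [:: false; true]|exists [:: true; false]].
case=> p /prefixP[s Eq] [p0 p1].
have [s0 s1] : count_mem false s = 1 /\ count_mem true s = 1.
  by move: q0 q1; rewrite Eq !count_cat p0 p1 !add1n => -[->] [->].
have two (r : bword) : count_mem false r = 1 -> count_mem true r = 1 ->
    r = [:: false; true] \/ r = [:: true; false].
  by case: r => [|[] [|[] [|[] r]]] //=; try lia; [right|left].
by rewrite Eq; case: (two p p0 p1) => ->; case: (two s s0 s1) => ->.
Qed.

Lemma L_intP l w :
  L_int l w <-> uniform (2 * l) w /\ odd_prefix false true w.
Proof.
have key k m : uniform (2 * l) w -> 1 <= k <= l -> 1 <= m <= l ->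
    count_mem false (delta 1 k m w) = 2 /\ count_mem true (delta 1 k m w) = 2.
  by case=> w0 w1 hk hm; rewrite !count_delta w0 w1; lia.
split=> [[uw [k [m [hk hm dE]]]]|[uw [p pw /andP[o0 o1]]]]; split=> //.
  have [d0 d1] := key k m uw hk hm.
  move: dE => /(delta_meetP d0 d1)[_ /prefix_delta[p pw ->]].
  rewrite !count_delta => -[p0 p1]; exists p => //.
  (* Exactly one kept occurrence in [p] means that it is the first one after the [2 * (k - 1)]
     skipped ones. *)
  have -> : count_mem false p = (2 * (k - 1)).+1 by lia.
  have -> : count_mem true p = (2 * (m - 1)).+1 by lia.
  by rewrite /= !oddM.
have [r Ew] := prefixP pw.
have le c : count_mem c p <= count_mem c w by rewrite Ew count_cat leq_addr.
move: (le false) (le true) (uw) => le0 le1 [w0 w1].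
(* Solves [2k - 1] and [2m - 1] for the two odd counts in [p]. *)
set k := uphalf (count_mem false p); set m := uphalf (count_mem true p).
have hk : 1 <= k <= l by rewrite /k; lia.
have hm : 1 <= m <= l by rewrite /m; lia.
exists k, m; split=> //; have [d0 d1] := key k m uw hk hm.
apply/(delta_meetP d0 d1); exists (delta 1 k m p).
  by apply/prefix_delta; exists p.
by rewrite !count_delta /k /m; lia.
Qed.

Section H.
Variables (A : eqType) (u v : A).
Hypothesis nuv : u != v.

Lemma count_h_false w : count_mem false (h u v w) = count_mem u w.
Proof.
elim: w => //= c w; rewrite /h /=; case: (c == u) => /= [->//|].
by case: (c == v) => /= ->.
Qed.

Lemma count_h_true w : count_mem true (h u v w) = count_mem v w.
Proof.
elim: w => //= c w; rewrite /h /=; have [->|_] := eqVneq c u.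
  by rewrite (negbTE nuv) => /= ->.
by case: (c == v) => /= ->.
Qed.

Lemma prefix_h s w : prefix s (h u v w) <-> exists2 p, prefix p w & s = h u v p.
Proof.
apply: prefix_image => // x c; rewrite /h -cats1 pmap_cat /=.
case: (c == u) => /=; first by right; exists false; rewrite cats1.
case: (c == v) => /=; first by right; exists true; rewrite cats1.
by left; rewrite cats0.
Qed.

Lemma odd_prefix_h w : odd_prefix false true (h u v w) <-> odd_prefix u v w.
Proof.
split=> [[_ /prefix_h[p pw ->]]|[p pw op]].
  by rewrite count_h_false count_h_true => op; exists p.
exists (h u v p); first by apply/prefix_h; exists p.
by rewrite count_h_false count_h_true.
Qed.

Lemma L_int_h l w :
  L_int l (h u v w) <->
  [/\ count_mem u w = 2 * l, count_mem v w = 2 * l & odd_prefix u v w].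
Proof.
rewrite L_intP odd_prefix_h /uniform count_h_false count_h_true.
by split=> [[[]]|[]].
Qed.

End H.

(** * Toggle counts of boolean sequences *)

(* Number of changes of value along [b :: s ++ [:: false]]. *)
Fixpoint toggles (b : bool) (s : seq bool) : nat :=
  if s is c :: s' then (b (+) c) + toggles c s' else b.

Lemma odd_toggles b s : odd (toggles b s) = b.
Proof. by elim: s b => [[]|c s IH b] //=; rewrite oddD IH oddb addbK. Qed.

(** A disjunction changes value only where one of its disjuncts does. *)
Lemma toggles_or (T : Type) (P Q : pred T) b c s :
  toggles (b || c) [seq P x || Q x | x <- s] <=
  toggles b (map P s) + toggles c (map Q s).
Proof.
elim: s b c => [|x s IH] b c /=; first by case: b c => [] [].
by have := IH (P x) (Q x); case: b c (P x) (Q x) => [] [] [] [] /=; lia.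
Qed.

Lemma toggles_has (T I : Type) (P : I -> pred T) r s :
  toggles false [seq has (fun i => P i x) r | x <- s] <=
  \sum_(i <- r) toggles false (map (P i) s).
Proof.
elim: r => [|i r IH]; first by rewrite big_nil; elim: s.
rewrite big_cons; apply: leq_trans (toggles_or (P i) _ false false s) _.
by rewrite leq_add2l.
Qed.

(** An increasing sequence enters an interval at most once and leaves it at most once: [out] treats
    the points beyond [b], [ins] those after entry. *)
Lemma toggles_interval (R : realDomainType) (a b : R) s :
  sorted <=%R s -> toggles false [seq (a <= x <= b)%R | x <- s] <= 2.
Proof.
move=> ss.
have out c (r : seq R) : (b < c)%R -> path <=%R c r ->
    toggles false [seq (a <= x <= b)%R | x <- r] = 0.
  elim: r c => //= x r IH c bc /andP[cx pr].
  have bx : (b < x)%R by exact: lt_le_trans cx.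
  by rewrite [(x <= b)%R]leNgt bx andbF /= (IH x).
have ins c (r : seq R) : (a <= c)%R -> path <=%R c r ->
    toggles true [seq (a <= x <= b)%R | x <- r] <= 1.
  elim: r c => //= x r IH c ac /andP[cx pr].
  have ax : (a <= x)%R by exact: le_trans cx.
  rewrite ax /=; case: (leP x b) => bx /=; first exact: IH pr.
  by rewrite (out x).
elim: s ss => //= x s IH ps; have /IH ss := path_sorted ps.
case: (leP a x) => ax; last by [].
by case: (leP x b) => bx //=; rewrite add1n ltnS (ins x).
Qed.

(** * From a sequence of vertex sets to a word *)

(* Reading [w] from states [b], [c] of [u], [v], where every letter switches its
   own state, both states are on at some time. *)
Fixpoint meet (A : eqType) (u v : A) (b c : bool) (w : seq A) : bool :=
  b && c || if w is x :: w' then meet u v (b (+) (x == u)) (c (+) (x == v)) w'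
            else false.

Section Meet.
Variables (A : eqType) (u v : A).

Lemma meetP b c w :
  reflect (exists2 p, prefix p w &
             (b (+) odd (count_mem u p)) && (c (+) odd (count_mem v p)))
          (meet u v b c w).
Proof.
elim: w b c => [|x w IH] b c; rewrite [meet _ _ _ _ _]/=.
  rewrite orbF; apply: (iffP idP) => [bc|[p]]; first by exists [::]; rewrite ?addbF.
  by rewrite prefixs0 => /eqP->; rewrite !addbF.
apply: (iffP orP) => [[bc|/IH[p pw op]]|[[|y p]]].
- by exists [::]; rewrite ?addbF ?prefix0s.
- exists (x :: p); first by rewrite prefix_cons eqxx.
  by rewrite /= !oddD !oddb !addbA.
- by rewrite !addbF; left.
- rewrite prefix_cons => /andP[/eqP-> pw] /=; rewrite !oddD !oddb !addbA => op.
  by right; apply/IH; exists p.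
Qed.

Lemma odd_prefixP w : reflect (odd_prefix u v w) (meet u v false false w).
Proof. exact: (meetP false false). Qed.

Lemma meet_cat b c s t :
  meet u v b c (s ++ t) =
  meet u v b c s ||
  meet u v (b (+) odd (count_mem u s)) (c (+) odd (count_mem v s)) t.
Proof.
elim: s b c => [|x s IH] b c /=.
  by rewrite !addbF orbF; case: t => [|x t] /=; case: (b && c).
by rewrite IH !oddD !oddb !addbA orbA.
Qed.

Lemma meet_start b c w : b && c -> meet u v b c w.
Proof. by case: w => [|x w] /= ->. Qed.

Lemma odd_count_uniq (x : A) s : uniq s -> odd (count_mem x s) = (x \in s).
Proof. by move/count_uniq_mem->; rewrite oddb. Qed.

Lemma mem_prefix (x : A) p s : prefix p s -> x \in p -> x \in s.
Proof. by case/prefixP=> r ->; rewrite mem_cat => ->. Qed.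

(** When letters are only switched off, the most favourable time is the start. *)
Lemma meet_fall (b c : bool) s :
  uniq s -> (u \in s -> b) -> (v \in s -> c) -> meet u v b c s = b && c.
Proof.
move=> us sb sc; apply/idP/idP => [/meetP[p ps]|]; last exact: meet_start.
rewrite !odd_count_uniq ?(prefix_uniq ps) //.
have := mem_prefix (x := u) ps; have := mem_prefix (x := v) ps.
move: sb sc; case: (u \in s); case: (u \in p); case: (v \in s); case: (v \in p);
by case: b c => [] [] //=; tauto.
Qed.

(** When letters are only switched on, the most favourable time is the end. *)
Lemma meet_rise (b c : bool) s : uniq s -> (u \in s -> ~~ b) -> (v \in s -> ~~ c) ->
  meet u v b c s = (b (+) (u \in s)) && (c (+) (v \in s)).
Proof.
move=> us sb sc; apply/idP/idP => [/meetP[p ps]|bc]; last first.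
  by apply/meetP; exists s; rewrite ?prefix_refl // !odd_count_uniq.
rewrite !odd_count_uniq ?(prefix_uniq ps) //.
have := mem_prefix (x := u) ps; have := mem_prefix (x := v) ps.
move: sb sc; case: (u \in s); case: (u \in p); case: (v \in s); case: (v \in p);
by case: b c => [] [] //=; tauto.
Qed.

End Meet.

Section Word.
Variable (V : finType).
Implicit Types (B T : {set V}) (s : seq {set V}).

(* The letters switched when the set of active vertices runs through [T], then
   the members of [s], then the empty set; departing vertices are switched first, so
   that the active set is at all times contained in one of these sets. *)
Fixpoint sets_word T s : seq V :=
  if s is B :: s' then enum (T :\: B) ++ enum (B :\: T) ++ sets_word B s'
  else enum T.

Lemma count_enum_set (x : V) T : count_mem x (enum T) = (x \in T).
Proof. by rewrite count_uniq_mem ?enum_uniq // mem_enum. Qed.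

Lemma count_sets_word x T s :
  count_mem x (sets_word T s) = toggles (x \in T) [seq x \in B | B : {set V} <- s].
Proof.
elim: s T => [|B s IH] T /=; first exact: count_enum_set.
rewrite !count_cat !count_enum_set IH !inE addnA.
by case: (x \in T); case: (x \in B).
Qed.

Lemma meet_sets_word u v T s :
  meet u v (u \in T) (v \in T) (sets_word T s) =
  has (fun B : {set V} => (u \in B) && (v \in B)) (T :: s).
Proof.
elim: s T => [|B s IH] T /=.
  by rewrite orbF meet_fall ?enum_uniq // mem_enum.
have E x : (x \in T) (+) (x \in T :\: B) (+) (x \in B :\: T) = (x \in B).
  by rewrite !inE; case: (x \in T); case: (x \in B).
rewrite !meet_cat !count_enum_set !oddb !E IH.
rewrite meet_fall ?enum_uniq //; last 2 first.
- by rewrite mem_enum inE => /andP[].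
- by rewrite mem_enum inE => /andP[].
rewrite meet_rise ?enum_uniq //; last 2 first.
- by rewrite mem_enum !inE; case: (u \in T); case: (u \in B).
- by rewrite mem_enum !inE; case: (v \in T); case: (v \in B).
by rewrite !mem_enum !E /=; case: (_ && _); case: (_ && _).
Qed.

Definition pad (n : V -> nat) : seq V := flatten [seq nseq (n x) x | x <- enum V].

Lemma count_pad (n : V -> nat) x : count_mem x (pad n) = n x.
Proof.
rewrite /pad count_flatten -map_comp sumnE big_map big_enum /=.
rewrite (bigD1 x) //= count_nseq /= eqxx mul1n big1 ?addn0 // => y nyx.
by rewrite count_nseq /= (negbTE nyx).
Qed.

(** Every block has even length, so it starts and ends with all letters off, and inside it only its
    own letter can be on. *)
Lemma meet_pad (n : V -> nat) u v : u != v -> (forall x, ~~ odd (n x)) ->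
  meet u v false false (pad n) = false.
Proof.
move=> nuv ev; rewrite /pad; elim: (enum V) => //= x r IH.
rewrite meet_cat !count_nseq !oddM !(negbTE (ev _)) !andbF IH orbF.
apply/negP => /meetP[p /mem_prefix pn] /=.
have pE y : odd (count_mem y p) -> y = x.
  case: (boolP (y \in p)) => [/pn|/count_memPn->//].
  by rewrite mem_nseq => /andP[_ /eqP].
by case/andP=> /pE eu /pE ev'; rewrite eu ev' eqxx in nuv.
Qed.

Lemma sets_word_graph l s :
    (forall x : V, toggles false [seq x \in B | B : {set V} <- s] <= 2 * l) ->
  exists w : seq V, (forall x, count_mem x w = 2 * l) /\
    forall u v, u != v -> (odd_prefix u v w <->
      has (fun B : {set V} => (u \in B) && (v \in B)) s).
Proof.
move=> le; set w0 := sets_word finset.set0 s.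
have cE x : count_mem x w0 = toggles false [seq x \in B | B : {set V} <- s].
  by rewrite count_sets_word inE.
exists (w0 ++ pad (fun x => 2 * l - count_mem x w0)); split=> [x|u v nuv].
  by rewrite count_cat count_pad subnKC // cE.
rewrite (rwP (odd_prefixP _ _ _)) meet_cat !cE !odd_toggles meet_pad //; last first.
  (* A run from the empty set back to the empty set switches each letter an even number of times, so
     an even number of occurrences is missing. *)
  by move=> x; rewrite oddB cE ?le // odd_toggles oddM.
have := meet_sets_word u v finset.set0 s; rewrite !inE orbF => -> /=.
by rewrite !inE.
Qed.

End Word.

(** * Interval representations *)

Section Position.
Variables (A : eqType) (w : seq A) (v : A).

(** The position, counted from 1, of the [n]-th occurrence of [v], with [pos 0 = 0]; the value is
    [(size w).+1] if there are too few occurrences. *)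
Definition pos n := find (fun i => n <= count_mem v (take i w)) (iota 0 (size w).+1).

(** Prefix counts are monotone in the length, so [pos] is their lower adjoint. *)
Lemma pos_le n i : n <= count_mem v w -> (pos n <= i) = (n <= count_mem v (take i w)).
Proof.
move=> nw; pose P i := (n <= count_mem v (take i w)).
have hP : has P (iota 0 (size w).+1).
  apply/hasP; exists (size w); first by rewrite mem_iota /= add0n.
  by rewrite /P take_size.
have ps : pos n < (size w).+1 by rewrite -[X in _ < X](size_iota 0) -has_find.
apply/idP/idP => [le|].
  have := nth_find 0 hP; rewrite -/(pos n) nth_iota // add0n /P => /leq_trans; apply.
  by rewrite -(cat_take_drop (pos n) (take i w)) count_cat take_takel // leq_addr.
apply: contraLR; rewrite -ltnNge => lt.
have := before_find 0 lt; rewrite nth_iota ?add0n; last exact: ltn_trans lt ps.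
by rewrite /P => ->.
Qed.

End Position.

Lemma prefix_take_iff (A : eqType) (P : seq A -> Prop) (w : seq A) :
  (exists2 p, prefix p w & P p) <-> exists i, P (take i w).
Proof.
split=> [[p /prefixP[s ->] Pp]|[i Pi]]; last first.
  by exists (take i w) => //; apply: prefix_take.
by exists (size p); rewrite take_size_cat.
Qed.

Section IntervalOfWord.
Variables (R : realType) (l : nat) (A : finType) (w : seq A).
Local Open Scope ring_scope.
Local Open Scope classical_set_scope.

(* The real point [i] lies in the [j]-th interval of [v] exactly when the prefix
   of length [i] has [2 * j + 1] occurrences of [v]. Letters that do not occur
   [2 * l] times give isolated vertices and get private negative points. *)
Definition left_end (v : A) (j : 'I_l) : R :=
  if count_mem v w == (2 * l)%N then (pos w v (2 * j).+1)%:R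
  else - (enum_rank v).+1%:R.

Definition right_end (v : A) (j : 'I_l) : R :=
  if count_mem v w == (2 * l)%N then (pos w v (2 * j).+2).-1%:R
  else - (enum_rank v).+1%:R.

Definition letter_set (v : A) : set R :=
  \bigcup_j `[left_end v j, right_end v j].

Lemma pos_in (v : A) (j : 'I_l) i : count_mem v w = (2 * l)%N ->
  ((pos w v (2 * j).+1 <= i <= (pos w v (2 * j).+2).-1)%N =
   (count_mem v (take i w) == (2 * j).+1)%N).
Proof.
move=> cv; have lj := ltn_ord j.
(* Positivity makes [.-1] a true predecessor: the interval ends just before the next occurrence. *)
have p0 : (0 < pos w v (2 * j).+2)%N.
  by rewrite ltnNge pos_le ?take0 //= cv; lia.
have -> : (i <= (pos w v (2 * j).+2).-1)%N = ~~ (pos w v (2 * j).+2 <= i)%N.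
  by rewrite -ltnNge; case: (pos _ _ _) p0.
rewrite !pos_le ?cv; [|lia|lia].
by set c := count_mem _ _; lia.
Qed.

Lemma left_le_right v j : left_end v j <= right_end v j.
Proof.
rewrite /left_end /right_end; case: eqP => // cv; rewrite ler_nat.
have lj := ltn_ord j.
(* If both occurrences were reached by length [i], removing one letter would still leave [2 * j + 1]
   of them, against the minimality of [i]. *)
have p1 : (pos w v (2 * j).+1 < pos w v (2 * j).+2)%N.
  rewrite ltnNge pos_le ?cv; last by lia.
  set i := pos w v (2 * j).+1.
  have : (0 < i)%N by rewrite ltnNge pos_le ?take0 //= cv; lia.
  case E : i => [//|i'] _.
  have : ~~ (i <= i')%N by rewrite E ltnn.
  rewrite pos_le ?cv; last by lia.
  have := count_cat (pred1 v) (take i' w) (take 1 (drop i' w)).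
  rewrite -takeD addn1 => ->.
  have := count_size (pred1 v) (take 1 (drop i' w)).
  rewrite size_take_min; set c1 := count_mem _ _; set c2 := count_mem _ _.
  by move: (geq_minl 1 (size (drop i' w))); lia.
by lia.
Qed.

Lemma letter_set_meet u v : u != v ->
  letter_set u `&` letter_set v !=set0 <->
  [/\ count_mem u w = (2 * l)%N, count_mem v w = (2 * l)%N & odd_prefix u v w].
Proof.
move=> nuv; split.
  case=> x [[j _ /=] + [k _ /=]]; rewrite !in_itv /= /left_end /right_end.
  (* A private negative point cannot lie in an interval whose left end is a natural number. *)
  have neg (n : nat) m : x <= - n.+1%:R -> m%:R <= x -> False.
    have : (0 <= m%:R :> R) by []. have : (0 < n.+1%:R :> R) by rewrite ltr0n.
    by lra.
  case: eqP => cu; case: eqP => cv /andP[au ub] /andP[av vb].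
  - split=> //; apply/prefix_take_iff.
    (* The larger left end is a natural number lying in both intervals, hence a usable prefix
       length. *)
    pose i := maxn (pos w u (2 * j).+1) (pos w v (2 * k).+1).
    exists i.
    have /eqP-> : count_mem u (take i w) == (2 * j).+1.
      rewrite -pos_in // leq_maxl /= geq_max -!(ler_nat R).
      by rewrite (le_trans au ub) (le_trans av ub).
    have /eqP-> : count_mem v (take i w) == (2 * k).+1.
      rewrite -pos_in // leq_maxr /= geq_max -!(ler_nat R).
      by rewrite (le_trans au vb) (le_trans av vb).
    by rewrite /= !oddM.
  - by case: (neg _ _ vb au).
  - by case: (neg _ _ ub av).
  (* Private points of distinct letters differ because their ranks do. *)
  - have /eqP : - (enum_rank u).+1%:R = - (enum_rank v).+1%:R :> R.
      by apply/le_anti; rewrite (le_trans au vb) (le_trans av ub).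
    rewrite eqr_opp eqr_nat eqSS => /eqP/val_inj/enum_rank_inj uv.
    by rewrite uv eqxx in nuv.
case=> cu cv /prefix_take_iff[i /andP[ou ov]].
have sub x : count_mem x w = (2 * l)%N -> odd (count_mem x (take i w)) ->
    letter_set x i%:R.
  move=> cx ox.
  have le : (count_mem x (take i w) <= 2 * l)%N.
    by rewrite -cx -{2}(cat_take_drop i w) count_cat leq_addr.
  (* An odd count [2j + 1] bounded by [2l] designates the interval of index [j < l]. *)
  have lt : ((count_mem x (take i w))./2 < l)%N by lia.
  exists (Ordinal lt) => //=; rewrite in_itv /= /left_end /right_end cx eqxx.
  by rewrite !ler_nat pos_in //=; apply/eqP; lia.
by exists i%:R; split; apply: sub.
Qed.

End IntervalOfWord.

Lemma graph_class_interval_graph (R : realType) l G :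
  graph_class (@L_int_exchange_closed l) G -> interval_graph R l G.
Proof.
case=> A [w [f [bf fE]]].
exists (fun x => @letter_set R l A w (val (f x))); split=> [x|x y nxy].
  exists (@left_end R l A w (val (f x))), (@right_end R l A w (val (f x))).
  by split=> // i; apply: left_le_right.
have nf : val (f x) != val (f y).
  by rewrite (inj_eq val_inj) (inj_eq (bij_inj bf)).
rewrite letter_set_meet // -L_int_h // -fE /= /word_adj.
rewrite -(inj_eq val_inj) nf /=.
by split=> [/set_mem|/mem_set].
Qed.

(** * From intervals to a word *)

Section WordOfIntervals.
Variables (R : realType) (l : nat) (G : sgraph) (a b : G -> 'I_l -> R).
Local Open Scope ring_scope.

Definition stabbed (x : R) : {set G} :=
  [set v | has (fun i => a v i <= x <= b v i) (enum 'I_l)].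

(* Two intersecting intervals share the larger of their left endpoints. *)
Definition left_ends : seq R :=
  sort <=%R [seq a p.1 p.2 | p <- enum {: G * 'I_l}].

Lemma mem_left_ends v i : a v i \in left_ends.
Proof.
by rewrite mem_sort; apply/mapP; exists (v, i); rewrite ?mem_enum.
Qed.

Lemma toggles_stabbed v :
  (toggles false [seq v \in B | B : {set G} <- map stabbed left_ends] <= 2 * l)%N.
Proof.
rewrite -map_comp.
rewrite (eq_map (g := fun x => has (fun i => a v i <= x <= b v i) (enum 'I_l)));
  last by move=> x /=; rewrite inE.
apply: leq_trans (toggles_has (fun i x => a v i <= x <= b v i) _ _) _.
apply: (@leq_trans (\sum_(i <- enum 'I_l) 2)%N).
  apply: leq_sum => i _; apply: toggles_interval.
  exact: (sort_sorted (@le_total _ _)).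
by rewrite big_enum /= sum_nat_const card_ord mulnC.
Qed.

Lemma has_stabbed u v :
    (forall v i, a v i <= b v i) ->
  has (fun B : {set G} => (u \in B) && (v \in B)) (map stabbed left_ends) <->
  exists x i j, (a u i <= x <= b u i) && (a v j <= x <= b v j).
Proof.
move=> ab; rewrite has_map; split.
  case/hasP=> x _ /=; rewrite !inE => /andP[/hasP[i _ xi] /hasP[j _ xj]].
  by exists x, i, j; rewrite xi.
case=> x [i [j /andP[/andP[ax xb] /andP[cx xd]]]]; apply/hasP.
exists (Num.max (a u i) (a v j)).
  by case: (leP (a u i)) => _; apply: mem_left_ends.
rewrite /= !inE; apply/andP; split; apply/hasP.
  exists i; first by rewrite mem_enum.
  by rewrite le_max lexx ge_max ab (le_trans cx xb).
exists j; first by rewrite mem_enum.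
by rewrite le_max lexx orbT ge_max ab (le_trans ax xd).
Qed.

End WordOfIntervals.

Lemma interval_graph_graph_class (R : realType) l G : 0 < l ->
  interval_graph R l G -> graph_class (@L_int_exchange_closed l) G.
Proof.
move=> l0 [f [fI fE]].
have [a /choice[b ab]] := choice fI.
have [w [cw wE]] := sets_word_graph (toggles_stabbed a b).
(* Since [l] is positive, every vertex occurs in [w], so the word graph has all of [G] as its
   vertices. *)
have mem v : v \in w by rewrite -has_pred1 has_count cw; lia.
exists G, w, (fun v => SeqSub (mem v)); split.
  exists val => [//|x]; exact: val_inj.
move=> u v; rewrite /= /word_adj -(inj_eq val_inj) /=.
have [->|nuv] := eqVneq u v; first by rewrite adj_irr.
rewrite /=; apply/idP/idP.
  move=> /set_mem/(L_int_h nuv)[_ _ /(wE _ _ nuv)].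
  rewrite has_stabbed; last by move=> x; case: (ab x).
  case=> x [i [j /andP[xi xj]]]; apply/fE => //; exists x.
  by rewrite (ab u).2 (ab v).2; split; [exists i|exists j]; rewrite //= in_itv.
move=> /(fE _ _ nuv)[x]; rewrite (ab u).2 (ab v).2 => -[[i _ xi] [j _ xj]].
apply/mem_set/(L_int_h nuv); split=> //; apply/(wE _ _ nuv)/has_stabbed.
  by move=> y; case: (ab y).
by exists x, i, j; move: xi xj; rewrite /= !in_itv /= => -> ->.
Qed.

Theorem theorem2 (R : realType) (l : nat) (hl : (1 <= l)%N) :
  uniform_lang (2 * l) (L_int l) /\
  forall G : sgraph,
    graph_class (@L_int_exchange_closed l) G <-> interval_graph R l G.
Proof.
split=> [w []//|G]; split; first exact: graph_class_interval_graph.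
exact: interval_graph_graph_class.
Qed.
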